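(* Let $\mathbb{K}=\mathbb{R}$ or $\mathbb{C}$, and let $A\in\mathbb{K}^{m\times n}$, $B\in\mathbb{K}^{n\times k}$ be two matrices of ranks $r_A,r_B$ with given singular value decompositions $A=U_A\Sigma_A V_A^*$ and $B=U_B\Sigma_B V_B^*$. Let $u_{B,i}\in\mathbb{K}^n$ denote the $i$-th column of $U_B$. If there exists a (possibly empty) set $J\subset\{1,\ldots,r_A\}$, indexing some of the first $r_A$ columns of $V_A$ (i.e. right singular vectors of $A$), such that $$\operatorname{span}\big(u_{B,i} \mid u_{B,i}\notin\mathcal{N}(A),\ i\in\{1,\ldots,r_B\}\big)=\mathcal{C}\big((V_A)_J\big),$$ then $(AB)^{+}=B^{+}A^{+}$.
   Context: $M^*$ is the conjugate transpose, $M^{+}$ the Moore--Penrose pseudoinverse, $\mathcal{C}(M)$ the column space and $\mathcal{N}(M)$ the null space of $M$. A singular value decomposition of $M\in\mathbb{K}^{p\times q}$ of rank $r$ is $M=U\Sigma V^*$ with $U\in\mathbb{K}^{p\times p}$, $V\in\mathbb{K}^{q\times q}$ unitary (orthogonal over $\mathbb{R}$) and $\Sigma=\operatorname{diag}(\sigma_1,\ldots,\sigma_r,0,\ldots,0)\in\mathbb{R}^{p\times q}$ with $\sigma_1\ge\cdots\ge\sigma_r>0$. For a set $J$ of column indices, $M_J$ is the submatrix of $M$ consisting of the columns indexed by $J$; for $J=\emptyset$ its column space is $\{0\}$. The span of the empty set is $\{0\}$. *)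

(* Defs.v *)
From HB Require Import structures.
From mathcomp Require Import all_boot all_order all_algebra.
From mathcomp Require Import boolp classical_sets reals.
From mathcomp.real_closed Require Import complex.
Set Implicit Arguments.
Unset Strict Implicit.
Unset Printing Implicit Defensive.
Import Order.TTheory GRing.Theory Num.Theory.
Local Open Scope ring_scope.

Variant base_field := Reals | Complexes.

Definition RorC (R : realType) (b : base_field) : numFieldType :=
  match b with Reals => R | Complexes => R[i] end.

Definition conjs (R : realType) (b : base_field) : RorC R b -> RorC R b :=
  match b return RorC R b -> RorC R b with
  | Reals => id
  | Complexes => @conjc R
  end.

Definition of_real (R : realType) (b : base_field) : R -> RorC R b :=
  match b return R -> RorC R b with
  | Reals => id
  | Complexes => real_complex R
  end.

Section Conjugation.
Variables (R : realType) (b : base_field).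
Local Notation K := (RorC R b).
Local Notation conj := (@conjs R b).

Lemma conjs_is_additive : zmod_morphism conj.
Proof. case: b => //=; exact: (rmorphB (@conjc R)). Qed.

Lemma conjs_is_multiplicative : monoid_morphism conj.
Proof.
case: b; split=> //=; [exact: (rmorph1 (@conjc R))|exact: (rmorphM (@conjc R))].
Qed.

HB.instance Definition _ := GRing.isZmodMorphism.Build K K conj conjs_is_additive.
HB.instance Definition _ :=
  GRing.isMonoidMorphism.Build K K conj conjs_is_multiplicative.

Lemma of_real_is_additive : zmod_morphism (@of_real R b).
Proof. case: b => //=; exact: (rmorphB (real_complex R)). Qed.

Lemma of_real_is_multiplicative : monoid_morphism (@of_real R b).
Proof.
case: b; split=> //=; exact: (rmorphM (real_complex R)).
Qed.

HB.instance Definition _ :=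
  GRing.isZmodMorphism.Build R K (@of_real R b) of_real_is_additive.
HB.instance Definition _ :=
  GRing.isMonoidMorphism.Build R K (@of_real R b) of_real_is_multiplicative.

Lemma conjsK : involutive conj.
Proof. by case: b => // x; apply: conjcK. Qed.

Lemma conjs_of_real x : conj (of_real b x) = of_real b x.
Proof. by case: b => //=; rewrite oppr0. Qed.

Lemma mul_conjs (x : K) : x * conj x = `|x| ^+ 2.
Proof.
case: b x => /= x; first by rewrite real_normK ?num_real // expr2.
by rewrite sqr_normc.
Qed.

End Conjugation.

Section Matrices.
Variables (R : realType) (b : base_field).
Local Notation K := (RorC R b).

Definition adjmx p q (M : 'M[K]_(p, q)) : 'M[K]_(q, p) :=
  map_mx (@conjs R b) M^T.

Definition unitary p (U : 'M[K]_p) : Prop := U *m adjmx U = 1%:M.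

Definition is_svd p q (M : 'M[K]_(p, q))
    (U : 'M[K]_p) (S : 'M[R]_(p, q)) (V : 'M[K]_q) : Prop :=
  [/\ unitary U, unitary V, M = U *m map_mx (@of_real R b) S *m adjmx V
    & exists sigma : nat -> R,
        [/\ forall i, (i < \rank M)%N -> 0 < sigma i,
            forall i j, (i <= j < \rank M)%N -> sigma j <= sigma i
          & S = \matrix_(i, j)
                  (if (i == j :> nat) && (i < \rank M)%N then sigma i else 0)]].

Definition penrose p q (M : 'M[K]_(p, q)) (X : 'M[K]_(q, p)) : Prop :=
  [/\ M *m X *m M = M, X *m M *m X = X,
      adjmx (M *m X) = M *m X & adjmx (X *m M) = X *m M].

(* The default value 0 is never used, by [pinvP]. *)
Definition pinv p q (M : 'M[K]_(p, q)) : 'M[K]_(q, p) := xget 0 (penrose M).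

Definition colspace p q (M : 'M[K]_(p, q)) : {vspace 'cV[K]_p} :=
  <<[seq col j M | j : 'I_q]>>%VS.

Definition nullspace p q (M : 'M[K]_(p, q)) : {vspace 'cV[K]_q} :=
  lker (linfun (mulmx M : 'cV[K]_q -> 'cV[K]_p)).

Definition colsel p q (M : 'M[K]_(p, q)) (J : {set 'I_q}) : 'M[K]_(p, #|J|) :=
  colsub (@enum_val _ (mem J)) M.

Lemma mem_nullspace p q (M : 'M[K]_(p, q)) (x : 'cV[K]_q) :
  (x \in nullspace M) = (M *m x == 0).
Proof. by rewrite memv_ker lfunE. Qed.

Lemma adjmxM p q r (M : 'M[K]_(p, q)) (N : 'M[K]_(q, r)) :
  adjmx (M *m N) = adjmx N *m adjmx M.
Proof. by rewrite /adjmx trmx_mul map_mxM. Qed.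

Lemma adjmxK p q (M : 'M[K]_(p, q)) : adjmx (adjmx M) = M.
Proof. by apply/matrixP => i j; rewrite !mxE conjsK. Qed.

Lemma adjmx_inv p (M : 'M[K]_p) : adjmx (invmx M) = invmx (adjmx M).
Proof. by rewrite /adjmx trmx_inv map_invmx. Qed.

Lemma penrose_unique p q (M : 'M[K]_(p, q)) (X Y : 'M[K]_(q, p)) :
  penrose M X -> penrose M Y -> X = Y.
Proof.
move=> [X1 X2 X3 X4] [Y1 Y2 Y3 Y4].
have MX : M *m X = M *m Y.
  by rewrite -X3 -{1}Y1 -(mulmxA (M *m Y)) adjmxM X3 Y3 mulmxA X1.
have XM : X *m M = Y *m M.
  rewrite -X4 -{1}Y1 2!mulmxA -(mulmxA (X *m M)) adjmxM X4 Y4.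
  by rewrite -!mulmxA (mulmxA M X) X1.
by rewrite -X2 -mulmxA MX mulmxA XM Y2.
Qed.

Lemma row_gram0 q (x : 'rV[K]_q) : x *m adjmx x = 0 -> x = 0.
Proof.
move=> /matrixP/(_ 0 0); rewrite !mxE => /eqP.
under eq_bigr do rewrite !mxE mul_conjs.
rewrite psumr_eq0 => [/allP x0|i _]; last exact: exprn_ge0.
apply/matrixP => i j; rewrite ord1 mxE; apply/eqP.
by have := x0 j (mem_index_enum _); rewrite sqrf_eq0 normr_eq0.
Qed.

Lemma gram_unit p q (M : 'M[K]_(p, q)) : row_free M -> M *m adjmx M \in unitmx.
Proof.
move=> Mfree; rewrite -row_free_unit -kermx_eq0; apply/eqP/row_matrixP => i.
rewrite row0; apply: (row_free_inj Mfree); rewrite mul0mx.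
apply: row_gram0; rewrite adjmxM mulmxA -(mulmxA _ M).
by rewrite -row_mul mulmx_ker row0 mul0mx.
Qed.

Lemma penrose_exists p q (M : 'M[K]_(p, q)) : exists X, penrose M X.
Proof.
have [r [C [F [MCF Cfull Ffree]]]] : exists r (C : 'M[K]_(p, r)) (F : 'M_(r, q)),
    [/\ M = C *m F, row_full C & row_free F].
  exists (\rank M), (col_base M), (row_base M).
  by rewrite mulmx_base col_base_full row_base_free.
have uF : F *m adjmx F \in unitmx by apply/gram_unit.
have uC : adjmx C *m C \in unitmx.
  rewrite -{2}(adjmxK C); apply: gram_unit.
  by rewrite /row_free /adjmx mxrank_map mxrank_tr.
pose G := invmx (F *m adjmx F); pose H := invmx (adjmx C *m C).
have FG : F *m adjmx F *m G = 1%:M by rewrite mulmxV.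
have HC : H *m (adjmx C *m C) = 1%:M by rewrite mulVmx.
have Gh : adjmx G = G by rewrite adjmx_inv adjmxM adjmxK.
have Hh : adjmx H = H by rewrite adjmx_inv adjmxM adjmxK.
pose X := adjmx F *m G *m H *m adjmx C.
have MX : M *m X = C *m H *m adjmx C.
  by rewrite MCF /X -!mulmxA (mulmxA F) (mulmxA (F *m _)) FG mul1mx.
have XM : X *m M = adjmx F *m G *m F.
  by rewrite MCF /X -!mulmxA (mulmxA (adjmx C)) (mulmxA H) HC mul1mx.
exists X; split.
- by rewrite MX MCF -!mulmxA (mulmxA (adjmx C)) (mulmxA H) HC mul1mx.
- by rewrite XM /X -!mulmxA (mulmxA F) (mulmxA (F *m _)) FG mul1mx.
- by rewrite MX !adjmxM adjmxK Hh mulmxA.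
- by rewrite XM !adjmxM adjmxK Gh mulmxA.
Qed.

Lemma pinvP p q (M : 'M[K]_(p, q)) : penrose M (pinv M).
Proof. by rewrite /pinv; apply: xgetPex; apply: penrose_exists. Qed.

Lemma pinv_eq p q (M : 'M[K]_(p, q)) X : penrose M X -> pinv M = X.
Proof. exact: penrose_unique (pinvP M). Qed.

End Matrices.

(* Main.v *)
Require Import Defs.
From mathcomp Require Import all_boot all_order all_algebra.
From mathcomp Require Import reals.
Set Implicit Arguments.
Unset Strict Implicit.
Unset Printing Implicit Defensive.
Import Order.TTheory GRing.Theory Num.Theory.
Local Open Scope ring_scope.

(** Write [P = B B^+] and [Q = A^+ A] for the orthogonal projections onto the
    column space of [B] and the row space of [A].  By Greville's criterion
    ([pinvM_commute]) the reverse order law holds as soon as [Q P] is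
    Hermitian and commutes with both [A^* A] and [B B^*].

    Let [E] be the orthogonal projection onto the common subspace [S] of the
    hypothesis.  On the one hand, [S] is spanned by some left singular vectors
    of [B] with nonzero singular value, so [P E = E] and [E] commutes with
    [B B^*]; on the other hand, it is spanned by some right singular vectors of
    [A] with nonzero singular value, so [Q E = E] and [E] commutes with
    [A^* A].  The left singular vectors spanning the column space of [B] that
    do not contribute to [S] are annihilated by [A], whence [A B = A E B].
    Multiplying by [A^+] on the left and by [B^+] on the right gives
    [Q P = Q E P = E], and Greville's criterion applies.

    Right singular vectors of [A] are left singular vectors of [A^*]
    ([is_svd_adj]), so each fact about singular vectors is proved on one side
    only. *)

(** * Reverse order law for commuting projections *)

Section ReverseOrderLaw.
Variables (R : realType) (b : base_field).
Local Notation K := (RorC R b).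

Lemma adjmx_diag p (d : 'rV[K]_p) :
  adjmx (diag_mx d) = diag_mx (map_mx (@conjs R b) d).
Proof. by rewrite /adjmx tr_diag_mx map_diag_mx. Qed.

Lemma adjmx_of_real p q (S : 'M[R]_(p, q)) :
  adjmx (map_mx (@of_real R b) S) = map_mx (@of_real R b) S^T.
Proof. by apply/matrixP => i j; rewrite !mxE conjs_of_real. Qed.

Lemma mxrank_adj p q (M : 'M[K]_(p, q)) : \rank (adjmx M) = \rank M.
Proof. by rewrite /adjmx mxrank_map mxrank_tr. Qed.

Lemma unitary_mulVmx p (U : 'M[K]_p) : unitary U -> adjmx U *m U = 1%:M.
Proof. exact: mulmx1C. Qed.

(** [M^* = (M M^+ M)^* = (M^+ M)^* M^*], and [M^+ M] is Hermitian. *)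
Lemma mul_pinv_adj p q (M : 'M[K]_(p, q)) : pinv M *m M *m adjmx M = adjmx M.
Proof.
have [M1 _ _ M4] := pinvP M.
by rewrite -{1}M4 -adjmxM mulmxA M1.
Qed.

Lemma mul_adj_pinv p q (M : 'M[K]_(p, q)) : adjmx M *m (M *m pinv M) = adjmx M.
Proof.
have [M1 _ M3 _] := pinvP M.
by rewrite -{1}M3 -adjmxM M1.
Qed.

(** [(M E M^+)^* = (M^+)^* E M^* M M^+ = (M^+)^* M^* M E M^+ = M E M^+], where
    the second equality is the commutation hypothesis. *)
Lemma adj_conj_pinv p q (M : 'M[K]_(p, q)) (E : 'M[K]_q) :
    adjmx E = E -> E *m (adjmx M *m M) = adjmx M *m M *m E ->
  adjmx (M *m E *m pinv M) = M *m E *m pinv M.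
Proof.
move=> Eh Ecomm; have [M1 _ M3 _] := pinvP M.
rewrite !adjmxM Eh -{1}(mul_adj_pinv M).
rewrite (mulmxA (adjmx M)) (mulmxA E) Ecomm !mulmxA.
by rewrite -adjmxM M3 M1.
Qed.

Lemma adj_pinv_conj p q (M : 'M[K]_(p, q)) (E : 'M[K]_p) :
    adjmx E = E -> E *m (M *m adjmx M) = M *m adjmx M *m E ->
  adjmx (pinv M *m E *m M) = pinv M *m E *m M.
Proof.
move=> Eh Ecomm; have [M1 _ _ M4] := pinvP M.
rewrite !adjmxM Eh -{1}(mul_pinv_adj M).
transitivity (pinv M *m (M *m adjmx M *m E) *m adjmx (pinv M)).
  by rewrite !mulmxA.
by rewrite -Ecomm -!mulmxA -adjmxM M4 (mulmxA M) M1.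
Qed.

(** The two products of [A B] with [B^+ A^+] are
    [A E A^+] and [B^+ E B], where [E = A^+ A B B^+]; that [E] is Hermitian
    means that the two projections commute, which yields the first two Penrose
    equations. *)
Lemma pinvM_commute m n k (A : 'M[K]_(m, n)) (B : 'M[K]_(n, k))
    (E := pinv A *m A *m (B *m pinv B)) :
    adjmx E = E -> E *m (adjmx A *m A) = adjmx A *m A *m E ->
    E *m (B *m adjmx B) = B *m adjmx B *m E ->
  pinv (A *m B) = pinv B *m pinv A.
Proof.
move=> Eh EA EB; have [A1 A2 _ A4] := pinvP A; have [B1 B2 B3 _] := pinvP B.
have PQ : B *m pinv B *m (pinv A *m A) = E.
  by rewrite -Eh /E adjmxM A4 B3.
have AE : A *m E = A *m B *m pinv B by rewrite /E !mulmxA A1.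
have EB' : E *m B = pinv A *m A *m B by rewrite /E -!mulmxA (mulmxA B) B1.
have MX : A *m B *m (pinv B *m pinv A) = A *m E *m pinv A.
  by rewrite AE !mulmxA.
have XM : pinv B *m pinv A *m (A *m B) = pinv B *m E *m B.
  by rewrite -(mulmxA _ E) EB' !mulmxA.
apply: pinv_eq; split.
- transitivity (A *m (B *m pinv B *m (pinv A *m A)) *m B).
    by rewrite !mulmxA.
  by rewrite PQ -mulmxA EB' !mulmxA A1.
- transitivity (pinv B *m E *m pinv A); first by rewrite /E !mulmxA.
  by rewrite -PQ !mulmxA B2 -!mulmxA (mulmxA (pinv A)) A2.
- by rewrite MX adj_conj_pinv.
- by rewrite XM adj_pinv_conj.
Qed.

(** * Projections onto spans of columns of a unitary matrix *)

(** The orthogonal projection onto the span of the columns of [U] indexed by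
    [I], when [U] is unitary. *)
Definition colproj p (U : 'M[K]_p) (I : {set 'I_p}) : 'M[K]_p :=
  U *m diag_mx (\row_i (i \in I)%:R) *m adjmx U.

Lemma adj_colproj p (U : 'M[K]_p) I : adjmx (colproj U I) = colproj U I.
Proof.
rewrite /colproj !adjmxM adjmxK adjmx_diag mulmxA; congr (_ *m diag_mx _ *m _).
by apply/rowP => i; rewrite !mxE rmorph_nat.
Qed.

Lemma colproj_col p (U : 'M[K]_p) (I : {set 'I_p}) i :
  unitary U -> i \in I -> colproj U I *m col i U = col i U.
Proof.
move=> Uu iI; rewrite /colproj colE -!mulmxA (mulmxA (adjmx U)).
rewrite unitary_mulVmx // mul1mx; congr (_ *m _).
apply/matrixP => j l; rewrite mul_diag_mx !mxE.
by case: (eqVneq j i) => [->|_]; rewrite ?iI ?mul1r ?mulr0.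
Qed.

Lemma mul_colproj_id p (U : 'M[K]_p) (I : {set 'I_p}) (M : 'M[K]_p) :
  (forall i, i \in I -> M *m col i U = col i U) ->
  M *m colproj U I = colproj U I.
Proof.
move=> MU; rewrite /colproj !mulmxA; congr (_ *m _).
apply/matrixP => i j; rewrite !mul_mx_diag !mxE.
case: (boolP (j \in I)) => jI; last by rewrite !mulr0.
have /matrixP/(_ i 0) := MU j jI; rewrite !mxE => <-.
by congr (_ * _); apply: eq_bigr => l _; rewrite !mxE.
Qed.

Lemma colproj_absorb p (U V : 'M[K]_p) (I J : {set 'I_p}) :
    unitary V ->
    (<<[seq col i U | i in I]>> <= <<[seq col j V | j in J]>>)%VS ->
  colproj V J *m colproj U I = colproj U I.
Proof.
move=> Vu sUV; apply: mul_colproj_id => i iI.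
(* the fixed vectors of a matrix form a subspace, so generators suffice *)
have sV : (<<[seq col j V | j in J]>> <= nullspace (colproj V J - 1%:M))%VS.
  apply/span_subvP => _ /imageP[j jJ ->].
  by rewrite mem_nullspace mulmxBl mul1mx colproj_col ?subrr.
have : col i U \in nullspace (colproj V J - 1%:M).
  by apply: (subvP sV); apply: (subvP sUV); apply/memv_span/image_f.
by rewrite mem_nullspace mulmxBl mul1mx subr_eq0 => /eqP.
Qed.

(** Two Hermitian matrices each of which absorbs the other are equal. *)
Lemma colproj_eq p (U V : 'M[K]_p) (I J : {set 'I_p}) :
    unitary U -> unitary V ->
    <<[seq col i U | i in I]>>%VS = <<[seq col j V | j in J]>>%VS ->
  colproj U I = colproj V J.
Proof.
move=> Uu Vu eqUV.
have VU := @colproj_absorb _ U V I J Vu; rewrite eqUV subvv in VU.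
have UV := @colproj_absorb _ V U J I Uu; rewrite eqUV subvv in UV.
by rewrite -VU // -{1}adj_colproj -[X in _ *m X]adj_colproj -adjmxM UV //
  adj_colproj.
Qed.

Lemma span_colsel p q (V : 'M[K]_(p, q)) (J : {set 'I_q}) :
  colspace (colsel V J) = <<[seq col j V | j in J]>>%VS.
Proof.
have colJ c : col c (colsel V J) = col (enum_val c) V.
  by apply/matrixP => i j; rewrite !mxE.
apply: eq_span => x; apply/imageP/imageP => [[c _ ->]|[j jJ ->]].
  by exists (enum_val c); rewrite ?enum_valP.
by exists (enum_rank_in jJ j); rewrite // colJ enum_rankK_in.
Qed.

(** * Spans of singular vectors *)

Lemma is_svd_adj p q (M : 'M[K]_(p, q)) U S V :
  is_svd M U S V -> is_svd (adjmx M) V S^T U.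
Proof.
move=> [Uu Vu eM [s [s0 sle eS]]]; split=> //.
  by rewrite {1}eM !adjmxM adjmxK adjmx_of_real mulmxA.
exists s; rewrite mxrank_adj; split=> //.
apply/matrixP => i j; rewrite eS !mxE eq_sym.
by case: eqP => [->|].
Qed.

Section SingularVectors.
Variables (p q : nat) (M : 'M[K]_(p, q)).
Variables (U : 'M[K]_p) (S : 'M[R]_(p, q)) (V : 'M[K]_q).
Hypothesis svdM : is_svd M U S V.

(** [M M^*] is diagonal in the basis of left singular vectors. *)
Lemma colproj_gram I :
  colproj U I *m (M *m adjmx M) = M *m adjmx M *m colproj U I.
Proof.
have [Uu Vu eM [s [_ _ eS]]] := svdM.
have eG : M *m adjmx M =
    U *m map_mx (@of_real R b) (S *m S^T) *m adjmx U.
  rewrite eM !adjmxM adjmxK adjmx_of_real map_mxM -!mulmxA.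
  by rewrite (mulmxA (adjmx V)) unitary_mulVmx // mul1mx.
rewrite eG /colproj -!mulmxA 2!(mulmxA (adjmx U) U) unitary_mulVmx // !mul1mx.
congr (_ *m _); rewrite !mulmxA; congr (_ *m _).
apply/matrixP => i j; rewrite mul_diag_mx mul_mx_diag [LHS]mxE [RHS]mxE.
case: (eqVneq i j) => [->|ij]; first by rewrite mulrC.
suff -> : (map_mx (@of_real R b) (S *m S^T)) i j = 0 by rewrite mulr0 mul0r.
rewrite !mxE big1 ?rmorph0 // => l _; rewrite eS !mxE.
case: (eqVneq (i : nat) l) => [il|_]; last by rewrite mul0r.
case: (eqVneq (j : nat) l) => [jl|_]; last by rewrite mulr0.
by case/eqP: ij; apply/val_inj; apply: etrans il (esym jl).
Qed.

(** Singular vectors with nonzero singular value lie in the range of [M]: a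
    diagonal matrix supported there factors through [S]. *)
Lemma mul_pinv_colproj (I : {set 'I_p}) :
    (forall i, i \in I -> (i < \rank M)%N) ->
  M *m pinv M *m colproj U I = colproj U I.
Proof.
move=> ltI; have [Uu Vu eM [s [s0 _ eS]]] := svdM.
have [M1 _ _ _] := pinvP M.
pose T : 'M[R]_(q, p) := \matrix_(l, j)
  if (l == j :> nat) && (j \in I) then (s j)^-1 else 0.
suff -> : colproj U I = M *m (V *m map_mx (@of_real R b) T *m adjmx U).
  by rewrite mulmxA M1.
rewrite eM -!mulmxA (mulmxA (adjmx V)) unitary_mulVmx // mul1mx /colproj.
rewrite -!mulmxA; congr (_ *m _); rewrite !mulmxA -map_mxM; congr (_ *m _).
apply/matrixP => i j; rewrite !mxE.
case: (boolP (j \in I)) => jI; last first.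
  rewrite [in RHS]big1 ?rmorph0 => [|l _]; last first.
    by rewrite !mxE (negPf jI) andbF mulr0.
  by case: (eqVneq i j) => [->|_]; rewrite ?(negPf jI) ?mul0rn.
have jq : (j < q)%N := leq_trans (ltI j jI) (rank_leq_col M).
rewrite (bigD1 (Ordinal jq)) //= [in RHS]big1 ?addr0 => [|l nlj]; last first.
  move: nlj; rewrite -val_eqE /= => /negPf nlj.
  by rewrite !mxE nlj mulr0.
rewrite eS !mxE /= eqxx jI /= val_eqE.
case: (eqVneq i j) => [->|nij]; last by rewrite mul0r rmorph0.
by rewrite jI ltI //= mulfV ?rmorph1 // gt_eqF // s0 // ltI.
Qed.

(** The columns of [M] only involve the first [\rank M] columns of [U], so
    those of them that a matrix annihilates may be projected away. *)
Lemma mul_colproj_svd r (A : 'M[K]_(r, p)) (I : {set 'I_p}) :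
    (forall i : 'I_p, (i < \rank M)%N -> i \notin I -> A *m col i U = 0) ->
  A *m colproj U I *m M = A *m M.
Proof.
move=> AU; have [Uu Vu eM [s [_ _ eS]]] := svdM.
rewrite [in LHS]eM [in RHS]eM /colproj -!mulmxA (mulmxA (adjmx U) U).
rewrite unitary_mulVmx // mul1mx !mulmxA; congr (_ *m _).
apply/matrixP => i j; rewrite mul_mx_diag !mxE; apply: eq_bigr => l _.
rewrite !mxE; case: (boolP (l \in I)) => lI; first by rewrite mulr1.
rewrite eS !mxE mulr0 mul0r; case: ifP => [/andP[_ lr]|_]; last first.
  by rewrite rmorph0 mulr0.
have /matrixP/(_ i 0) := AU l lr lI; rewrite !mxE => AU0.
rewrite (_ : \sum_j _ = 0) ?mul0r // -[RHS]AU0.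
by apply: eq_bigr => t _; rewrite !mxE.
Qed.

End SingularVectors.
End ReverseOrderLaw.

(** * The sufficient condition on singular vectors *)

Theorem theorem3p1 (R : realType) (b : base_field) (m n k : nat)
    (A : 'M[RorC R b]_(m, n)) (B : 'M[RorC R b]_(n, k))
    (UA : 'M[RorC R b]_m) (SA : 'M[R]_(m, n)) (VA : 'M[RorC R b]_n)
    (UB : 'M[RorC R b]_n) (SB : 'M[R]_(n, k)) (VB : 'M[RorC R b]_k)
    (svdA : is_svd A UA SA VA) (svdB : is_svd B UB SB VB)
    (hJ : exists J : {set 'I_n},
        (forall j, j \in J -> (j < \rank A)%N) /\
        <<[seq col i UB | i : 'I_n <- enum 'I_n &
             (i < \rank B)%N && (col i UB \notin nullspace A)]>>%VS
        = colspace (colsel VA J)) :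
  pinv (A *m B) = pinv B *m pinv A.
Proof.
have [J [ltJ eqS]] := hJ.
pose I := [set i : 'I_n | (i < \rank B)%N && (col i UB \notin nullspace A)].
have [UBu _ _ _] := svdB; have [_ VAu _ _] := svdA.
pose E := colproj UB I.
have EJ : E = colproj VA J.
  apply: colproj_eq => //; rewrite -(span_colsel VA) -eqS /image_mem.
  suff -> : enum I = [seq i : 'I_n <- enum 'I_n |
      (i < \rank B)%N && (col i UB \notin nullspace A)] by [].
  by rewrite -filter_predI; apply: eq_filter => i; rewrite /= !inE andbT.
have svdA' := is_svd_adj svdA.
have PE : B *m pinv B *m E = E.
  by apply: (mul_pinv_colproj svdB) => i; rewrite inE => /andP[].
have QE : pinv A *m A *m E = E.
  have ltJ' j : j \in J -> (j < \rank (adjmx A))%N.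
    by rewrite mxrank_adj; apply: ltJ.
  rewrite EJ -(mul_pinv_colproj svdA' ltJ') !mulmxA.
  by rewrite mul_pinv_adj.
have AEB : A *m E *m B = A *m B.
  apply: (mul_colproj_svd svdB) => i ir.
  by rewrite inE ir /= negbK mem_nullspace => /eqP.
have QP : pinv A *m A *m (B *m pinv B) = E.
  have [_ _ B3 _] := pinvP B.
  have Eh : adjmx E = E by apply: adj_colproj.
  have EP : E *m (B *m pinv B) = E by rewrite -B3 -{1}Eh -adjmxM PE Eh.
  by rewrite mulmxA -(mulmxA _ A B) -AEB 2!(mulmxA (pinv A)) QE -mulmxA.
apply: pinvM_commute; rewrite QP.
- exact: adj_colproj.
- by have := colproj_gram svdA' J; rewrite adjmxK -EJ.
- exact: colproj_gram svdB I.
Qed.
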